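(* Let $n,r$ be positive integers, and let $h(x)$ be a polynomial with nonnegative (real) coefficients. If the polynomial sequence $\left( h^{\langle r,r-1 \rangle}(x),\ldots, h^{\langle r,1 \rangle}(x), h^{\langle r, 0 \rangle}(x) \right)$ is interlacing, then so is the polynomial sequence $\left(U_{r,r-1}^{n}\,h(x),\ldots, U_{r,1}^{n}\,h(x), U_{r,0}^{n}\,h(x)\right)$.
   Context: Sections of a polynomial. Fix a positive integer $r$. For a polynomial (or formal power series) $f(x)$, the series $f^{\langle r,0 \rangle}(x),\ldots,f^{\langle r,r-1 \rangle}(x)$ are the uniquely determined ones with $$f(x) = f^{\langle r,0 \rangle}(x^r)+xf^{\langle r,1 \rangle}(x^r)+ \cdots +x^{r-1}f^{\langle r,r-1 \rangle}(x^r).$$ That is, $f^{\langle r,k\rangle}(x)=\sum_i f_{ri+k}x^i$ if $f(x)=\sum_i f_i x^i$. The operator $U$. For a positive integer $n$ and $0\le k\le r-1$, define $$U_{r,k}^{n}\, h(x) = \left((1+x+\cdots+x^{r-1})^{n} h(x)\right)^{\langle r,k \rangle}.$$ Interlacing. A polynomial is real-rooted if all its zeros are real (nonzero constants are real-rooted). For real-rooted polynomials $f,g$ with positive leading coefficients, write $g\preceq f$ (''$g$ interlaces $f$'') if $\deg f=\deg g$ or $\deg f=\deg g+1$, and the zeros alternate as $\cdots\le v_2\le u_2\le v_1\le u_1$, where the $u_i$ are the zeros of $f$ and the $v_j$ the zeros of $g$, listed with multiplicity in weakly decreasing order. By convention, $a\preceq bx+c$ for any nonnegative reals $a,b,c$,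 and $0\preceq f$ and $f\preceq 0$ for any real-rooted polynomial $f$ (also $0\preceq 0$). A sequence $(f_1(x),\ldots,f_m(x))$ of real polynomials, each either zero or with positive leading coefficient, is interlacing if $f_i\preceq f_j$ for all $1\le i<j\le m$. *)

(* Defs.v *)
From HB Require Import structures.
From mathcomp Require Import all_boot all_order all_algebra.
From mathcomp Require Import reals complex.

Set Implicit Arguments.
Unset Strict Implicit.
Unset Printing Implicit Defensive.

Import Order.TTheory GRing.Theory Num.Theory.

Local Open Scope ring_scope.

(* The bound [size f] is large enough only for [0 < r]; see [coef_poly_section]
   and [poly_section_sum]. *)
Definition poly_section (R : nzRingType) (r k : nat) (f : {poly R}) : {poly R} :=
  \poly_(i < size f) f`_(r * i + k).

Lemma coef_poly_section (R : nzRingType) (r k : nat) (f : {poly R}) (i : nat) :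
  (0 < r)%N -> (poly_section r k f)`_i = f`_(r * i + k).
Proof.
move=> r_gt0; rewrite coef_poly; case: ltnP => // le_f_i.
by rewrite nth_default // (leq_trans le_f_i) // (leq_trans (leq_pmull i r_gt0)) ?leq_addr.
Qed.

Lemma poly_section_sum (R : comNzRingType) (r : nat) (f : {poly R}) :
  (0 < r)%N ->
  f = \sum_(k < r) 'X^k * (poly_section r k f \Po 'X^r).
Proof.
move=> r_gt0; apply/polyP => m; rewrite coef_sum.
have mP := ltn_pmod m r_gt0.
rewrite (bigD1 (Ordinal mP)) //= big1 ?addr0 => [|k neq_k].
  rewrite coefXnM ltnNge leq_mod /= coef_comp_poly_Xn //.
  have -> : (m - m %% r = m %/ r * r)%N by rewrite {1}(divn_eq m r) addnK.
  by rewrite dvdn_mull // mulnK // coef_poly_section // mulnC -divn_eq.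
rewrite coefXnM; case: ltnP => // le_k_m.
rewrite coef_comp_poly_Xn //; case: ifP => // r_dvd; case/eqP: neq_k.
apply: val_inj => /=; rewrite -(subnK le_k_m) -modnDml (eqP r_dvd) add0n.
by rewrite modn_small.
Qed.

Definition U (R : nzRingType) (r k n : nat) (h : {poly R}) : {poly R} :=
  poly_section r k ((\sum_(i < r) 'X^i) ^+ n * h).

(* Zeros are taken in the complex field [R[i]]. Nonzero constants satisfy the
   condition vacuously; the zero polynomial does not satisfy it. *)
Definition real_rooted (R : realType) (p : {poly R}) : Prop :=
  forall z : R[i], root (map_poly (real_complex R) p) z -> z \is Num.real.

Definition zeros_with_mult (R : realType) (p : {poly R}) (s : seq R) : Prop :=
  sorted (fun x y => y <= x) s /\ forall a : R, count_mem a s = mup a p.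

(* With 0-based indices: v_i <= u_i and u_(i+1) <= v_i whenever both exist. *)
Definition alternate (R : realType) (v u : seq R) : Prop :=
  (forall i : nat, (i < size v)%N -> (i < size u)%N -> v`_i <= u`_i) /\
  (forall i : nat, (i < size v)%N -> (i.+1 < size u)%N -> u`_i.+1 <= v`_i).

Variant interlaces (R : realType) (g f : {poly R}) : Prop :=
| InterlacesZeros (v u : seq R) of
    real_rooted g & real_rooted f &
    0 < lead_coef g & 0 < lead_coef f &
    size f = size g \/ size f = (size g).+1 &
    zeros_with_mult g v & zeros_with_mult f u & alternate v u
| InterlacesLinear (a b c : R) of
    0 <= a & 0 <= b & 0 <= c & g = a%:P & f = b *: 'X + c%:P
| InterlacesZeroLeft of g = 0 & (f = 0 \/ real_rooted f)
| InterlacesZeroRight of f = 0 & (g = 0 \/ real_rooted g).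

Definition interlacing (R : realType) (s : seq {poly R}) : Prop :=
  (forall f, f \in s -> f = 0 \/ 0 < lead_coef f) /\
  (forall i j : nat, (i < j)%N -> (j < size s)%N -> interlaces s`_i s`_j).

(* Main.v *)
Require Import Defs.
From mathcomp Require Import all_boot all_order all_algebra.
From mathcomp Require Import reals complex polyrcf.
From mathcomp Require Import ring lra zify.

(** Interlacing is turned into a family of inequalities that is bilinear in the
two polynomials, and the theorem becomes an identity between complex numbers.

For real-rooted [f] and [g] with positive leading coefficients, [g] interlaces
[f] exactly when [f / g] maps the open upper half-plane to the closed one, that
is, when [cross f(z) g(z)], the imaginary part of [f(z)] times the conjugate of
[g(z)], is nonnegative for all [z] with [Im z > 0]. If moreover the zeros are
nonpositive, as they are for nonnegative coefficients, [f] interlaces ['X * g],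
so that [cross (z * g(z)) f(z)] is nonnegative too. Geometrically, the argument
of [f(z)] lies between those of [g(z)] and of [z * g(z)].

Fix such a [z] and let [s k] be the value at [z] of the [k]-th section of [h].
The hypothesis says that [s (r-1), ..., s 0] run counterclockwise through the
cone from [s (r-1)] to [z * s (r-1)] ([in_fan]). Multiplying [h] by
[1 + 'X + ... + 'X^(r-1)] replaces [s k] by [wrapped_sum]:
[s 0 + ... + s k + z * (s (k+1) + ... + s (r-1))] ([poly_section_geomM]).
Splitting the sums at two indices leaves three vectors of the fan, for which
the new inequalities are explicit sums of nonnegative terms ([cross_fan3]). As a
fan spans a cone of angle less than pi, a new value vanishes only if all the old
ones do ([wrapped_sum_eq0]); hence the new sections are again real-rooted, or
zero if all the old ones were zero. Iterating [n] times gives the inequalities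
for [U r k n h].

Two translations remain. From zeros to inequalities ([cross_alternate]): if
[f = ('X - u1) * f1], then [f1] interlaces [g], and an induction that exchanges
the two polynomials at each step carries both inequalities. From inequalities to
zeros ([above_cross]): let [N_f a] and [N_g a] count the zeros above [a]. At a
real point [a] where the multiplicities of [f] and [g] differ by [k], the
quotient [f / g] behaves like [c * (z - a) ^+ k] or like [c / (z - a) ^+ k],
which maps the upper half-plane near [a] to its closure only if [k] is 0 or 1,
with the sign of [c] prescribed when [k] is 1 ([cross_local]). Since the sign of
[c] is the parity of [N_f a + N_g a], going down the real line the difference
[N_f - N_g] can only step from 0 to 1 and back, and this is the alternation of
the zeros. *)

Set Implicit Arguments.
Unset Strict Implicit.
Unset Printing Implicit Defensive.

Import Order.TTheory GRing.Theory Num.Theory.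

Local Open Scope ring_scope.

(** * The cross product of two complex numbers *)

(** The imaginary part of [w * z^*]: it is nonnegative when the angle from [z]
to [w] lies in the interval from 0 to pi. *)
Definition cross (R : rcfType) (w z : R[i]) : R :=
  complex.Im w * complex.Re z - complex.Re w * complex.Im z.

Definition sqmod (R : rcfType) (z : R[i]) : R :=
  complex.Re z ^+ 2 + complex.Im z ^+ 2.

Lemma sqmod_ge0 (R : rcfType) (z : R[i]) : 0 <= sqmod z.
Proof. by rewrite addr_ge0 ?sqr_ge0. Qed.

Lemma sqmod_eq0 (R : rcfType) (z : R[i]) : sqmod z = 0 -> z = 0.
Proof.
case: z => x y /eqP; rewrite paddr_eq0 ?sqr_ge0 //= !sqrf_eq0.
by move=> /andP[/eqP-> /eqP->].
Qed.

Lemma sqmod_gt0 (R : rcfType) (z : R[i]) : z != 0 -> 0 < sqmod z.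
Proof.
move=> z0; rewrite lt0r sqmod_ge0 andbT.
by apply: contra_neqN z0 => /eqP/sqmod_eq0.
Qed.

Lemma crossDl (R : rcfType) (v w z : R[i]) : cross (v + w) z = cross v z + cross w z.
Proof. by case: v w z => [a b] [c d] [x y]; rewrite /cross /=; ring. Qed.

Lemma crossC (R : rcfType) (w z : R[i]) : cross w z = - cross z w.
Proof. by case: w z => [c d] [x y]; rewrite /cross /=; ring. Qed.

Lemma cross0l (R : rcfType) (z : R[i]) : cross 0 z = 0.
Proof. by case: z => x y; rewrite /cross /= !mul0r subr0. Qed.

Lemma crossvv (R : rcfType) (z : R[i]) : cross z z = 0.
Proof. by rewrite /cross mulrC subrr. Qed.

Lemma crossNr (R : rcfType) (w z : R[i]) : cross w (- z) = - cross w z.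
Proof. by case: w z => [c d] [x y]; rewrite /cross /=; ring. Qed.

Lemma crossZl (R : rcfType) (t : R) (w z : R[i]) : cross (t%:C%C * w) z = t * cross w z.
Proof. by case: w z => [c d] [x y]; rewrite /cross /=; ring. Qed.

Lemma crossZr (R : rcfType) (t : R) (w z : R[i]) : cross w (t%:C%C * z) = t * cross w z.
Proof. by case: w z => [c d] [x y]; rewrite /cross /=; ring. Qed.

Lemma cross_suml (R : rcfType) (m n : nat) (F : nat -> R[i]) z :
  cross (\sum_(m <= i < n) F i) z = \sum_(m <= i < n) cross (F i) z.
Proof.
exact: (big_morph (fun w => cross w z) (fun v w => crossDl v w z) (cross0l z)).
Qed.

Lemma crossM2l (R : rcfType) (v w z : R[i]) :
  cross (v * w) (v * z) = sqmod v * cross w z.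
Proof. by case: v w z => [a b] [c d] [x y]; rewrite /cross /sqmod /=; ring. Qed.

Lemma crossMl (R : rcfType) (z w : R[i]) :
  cross (z * w) w = complex.Im z * sqmod w.
Proof. by case: z w => [a b] [c d]; rewrite /cross /sqmod /=; ring. Qed.

Lemma Im_pos_neq_real (R : rcfType) (z : R[i]) (a : R) : 0 < complex.Im z -> z - a%:C%C != 0.
Proof.
move=> z_gt0; rewrite subr_eq0; apply/eqP => zE.
by rewrite zE ltxx in z_gt0.
Qed.

(** * Fans of complex numbers *)

(** The vectors [s (r-1), ..., s 0] are met in this order when turning
counterclockwise from [s (r-1)] to [z * s (r-1)]. For [Im z > 0] this is a cone
of angle less than pi. *)
Definition in_fan (R : rcfType) (z : R[i]) (r : nat) (s : nat -> R[i]) : Prop :=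
  forall k l : nat, (k < l)%N -> (l < r)%N ->
    0 <= cross (s k) (s l) /\ 0 <= cross (z * s l) (s k).

(** The effect on the sections of multiplication by a geometric sum, see
[poly_section_geomM]: a section of higher index that is shifted past the index
[r - 1] re-enters with a factor [z]. It is used both for [z] a complex number and
for [z] the indeterminate. *)
Definition wrapped_sum (R : nzRingType) (z : R) (r : nat) (s : nat -> R) (k : nat) : R :=
  \sum_(0 <= i < k.+1) s i + z * \sum_(k.+1 <= i < r) s i.

(** Here [d, b, a] is a fan. In the second expansion the only term of unknown
sign is the cross product of [z ^+ 2 * d] and [a], since their angle may exceed
pi; together with the three terms [cross (z * a) a],
[cross (z * (z * d)) (z * d)] and [sqmod z * cross a d] it completes the square
[complex.Im z * sqmod (z * d + a)]. *)
Lemma cross_fan3 (R : rcfType) (z a b d : R[i]) : 0 < complex.Im z ->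
  0 <= cross a b -> 0 <= cross a d -> 0 <= cross b d ->
  0 <= cross (z * b) a -> 0 <= cross (z * d) b ->
  0 <= cross (a + z * (b + d)) (a + b + z * d) /\
  0 <= cross (z * (a + b + z * d)) (a + z * (b + d)).
Proof.
move=> z_gt0 ab ad bd zba zdb.
have -> : cross (a + z * (b + d)) (a + b + z * d) =
    cross a b + cross (z * b) a + cross (z * d) b
    + sqmod z * cross b d + complex.Im z * sqmod b.
  by case: z a b d {z_gt0 ab ad bd zba zdb} => [? ?] [? ?] [? ?] [? ?];
    rewrite /cross /sqmod /=; ring.
have -> : cross (z * (a + b + z * d)) (a + z * (b + d)) =
    complex.Im z * sqmod (z * d + a) + cross (z * b) a
    + sqmod z * (cross a b + cross b d + cross (z * d) b).
  by case: z a b d {z_gt0 ab ad bd zba zdb} => [? ?] [? ?] [? ?] [? ?];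
    rewrite /cross /sqmod /=; ring.
have [zI zN] := (ltW z_gt0, sqmod_ge0 z).
by split; do ?[exact: sqmod_ge0 | done | apply: addr_ge0 | apply: mulr_ge0].
Qed.

(** By bilinearity, the inequalities pass to the sums over two blocks of
consecutive indices, each of them comparing indices of the two blocks only. *)
Lemma in_fan_sum_ge0 (R : rcfType) (z : R[i]) (r : nat) (s : nat -> R[i])
    (i j k l : nat) : in_fan z r s -> (j <= k)%N -> (l <= r)%N ->
  0 <= cross (\sum_(i <= p < j) s p) (\sum_(k <= q < l) s q) /\
  0 <= cross (z * \sum_(k <= q < l) s q) (\sum_(i <= p < j) s p).
Proof.
move=> fan_s le_jk le_lr; rewrite mulr_sumr !cross_suml.
split; rewrite big_nat_cond; apply: sumr_ge0 => p /andP[/andP[? ltp] _];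
  rewrite crossC cross_suml -sumrN big_nat_cond;
  apply: sumr_ge0 => q /andP[/andP[? ltq] _]; rewrite -crossC.
- by have [] := fan_s p q (leq_trans ltp (leq_trans le_jk _)) (leq_trans ltq le_lr).
- by have [] := fan_s q p (leq_trans ltq (leq_trans le_jk _)) (leq_trans ltp le_lr).
Qed.

Lemma in_fan_wrapped_sum (R : rcfType) (z : R[i]) (r : nat) (s : nat -> R[i]) :
  0 < complex.Im z -> in_fan z r s -> in_fan z r (wrapped_sum z r s).
Proof.
move=> z_gt0 fan_s k l lt_kl lt_lr; rewrite /wrapped_sum.
rewrite (@big_cat_nat _ _ _ l.+1 k.+1 r) //; last exact: ltnW.
rewrite (@big_cat_nat _ _ _ k.+1 0 l.+1) //=; last exact: ltnW.
have fanS i j m p := @in_fan_sum_ge0 R z r s i j m p fan_s.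
have [ab zba] := fanS 0 k.+1 k.+1 l.+1 (leqnn _) lt_lr.
have [ad _] := fanS 0 k.+1 l.+1 r (ltnW lt_kl) (leqnn _).
have [bd zdb] := fanS k.+1 l.+1 l.+1 r (leqnn _) (leqnn _).
exact: cross_fan3.
Qed.

(** Vectors of a cone of angle less than pi that add up to zero are all zero.
If the sum of all but the last one is [- s j], the fan condition compares
[z * s j] with [- s j], which gives [complex.Im z * sqmod (s j) <= 0]. *)
Lemma in_fan_sum_eq0 (R : rcfType) (z : R[i]) (r : nat) (s : nat -> R[i]) (i j : nat) :
  0 < complex.Im z -> in_fan z r s -> (j <= r)%N -> \sum_(i <= p < j) s p = 0 ->
  forall p, (i <= p < j)%N -> s p = 0.
Proof.
move=> z_gt0 fan_s; elim: j => [|j IHj] lt_jr sum0 p; first by rewrite ltn0 andbF.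
case: (leqP i j) => [le_ij|lt_ji]; last first.
  by rewrite ltnS => /andP[/leq_trans le /le]; rewrite leqNgt lt_ji.
move: sum0; rewrite big_nat_recr //= => /eqP; rewrite addr_eq0 => /eqP sumE.
have [_] := @in_fan_sum_ge0 R z r s i j j j.+1 fan_s (leqnn _) lt_jr.
rewrite sumE big_nat1 crossNr crossMl oppr_ge0 pmulr_rle0 // => sj_le0.
have sj0 : s j = 0 by apply: sqmod_eq0; apply/le_anti; rewrite sj_le0 sqmod_ge0.
rewrite ltnS (leq_eqVlt p) => /andP[le_ip /orP[/eqP->//|lt_pj]].
by apply: IHj; rewrite ?le_ip ?sumE ?sj0 ?oppr0 // ltnW.
Qed.

(** If the wrapped sum [a + z * b] vanishes, then the condition [0 <= cross a b]
reads [complex.Im z * sqmod b <= 0]. So [b] and [a] vanish, and both are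
sums of vectors of the fan. *)
Lemma wrapped_sum_eq0 (R : rcfType) (z : R[i]) (r : nat) (s : nat -> R[i]) (k : nat) :
  0 < complex.Im z -> in_fan z r s -> (k < r)%N -> wrapped_sum z r s k = 0 ->
  forall p, (p < r)%N -> s p = 0.
Proof.
move=> z_gt0 fan_s lt_kr /eqP; rewrite addr_eq0 => /eqP sumE p lt_pr.
have [+ _] := @in_fan_sum_ge0 R z r s 0 k.+1 k.+1 r fan_s (leqnn _) (leqnn _).
rewrite sumE; set b := \sum_(k.+1 <= i < r) s i.
rewrite crossC crossNr opprK crossC crossMl oppr_ge0 pmulr_rle0 // => b_le0.
have b0 : b = 0 by apply: sqmod_eq0; apply/le_anti; rewrite b_le0 sqmod_ge0.
have a0 : \sum_(0 <= i < k.+1) s i = 0 by rewrite sumE -/b b0 mulr0 oppr0.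
case: (leqP p k) => [le_pk|lt_kp].
  exact: (in_fan_sum_eq0 z_gt0 fan_s lt_kr a0).
by apply: (in_fan_sum_eq0 z_gt0 fan_s (leqnn r) b0); rewrite lt_kp.
Qed.

(** * Real-rooted polynomials as products of linear factors *)

Notation cpoly p := (map_poly (real_complex _) p).

Definition lin_prod (R : nzRingType) (s : seq R) : {poly R} := \prod_(a <- s) ('X - a%:P).

Lemma horner_lin_prodC (R : rcfType) (s : seq R) (z : R[i]) :
  (cpoly (lin_prod s)).[z] = \prod_(a <- s) (z - a%:C%C).
Proof.
rewrite /lin_prod rmorph_prod horner_prod; apply: eq_bigr => a _.
by rewrite rmorphB /= map_polyX map_polyC hornerXsubC.
Qed.

(** The nonreal zeros of a real polynomial come in conjugate pairs. *)
Lemma real_rooted_im_gt0 (R : realType) (p : {poly R}) :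
  (forall z, 0 < complex.Im z -> (cpoly p).[z] != 0) <-> real_rooted p.
Proof.
split=> [noroot z rz|rr z z_gt0]; last first.
  by apply/negP => /rr; case: z z_gt0 => x y /= y_gt0; rewrite complex_real gt_eqF.
case: z rz => x y rz; rewrite complex_real; apply/eqP.
have [||//] := ltrgtP y 0 => y0.
  have := noroot (Complex x (- y)); rewrite /= oppr_gt0 => /(_ y0)/negP[].
  have pE : map_poly conjc (cpoly p) = cpoly p.
    by apply/polyP => i; rewrite !coef_map /= oppr0.
  by rewrite -[_ == 0]/(root _ _) -pE complex_root_conj /= opprK.
by have /(_ y0) := noroot (Complex x y); rewrite -[_ == 0]/(root _ _) rz.
Qed.

Lemma real_rooted_lin_prod (R : realType) (p : {poly R}) :
  real_rooted p -> p != 0 ->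
  exists2 w, sorted (fun x y => y <= x) w & p = lead_coef p *: lin_prod w.
Proof.
move=> rr p_neq0; have [s sE] := closed_field_poly_normal (cpoly p).
have s_real w : w \in s -> (complex.Re w)%:C%C = w.
  move=> ws; apply/RRe_real/rr; rewrite sE rootZ ?root_prod_XsubC //.
  by rewrite lead_coef_eq0 map_poly_eq0.
exists (sort (fun x y => y <= x) (map (@complex.Re R) s)).
  by apply: sort_sorted => x y; apply: le_total.
apply: (@map_poly_inj _ _ (real_complex R)); rewrite {1}sE lead_coef_map linearZ /=.
congr (_ *: _); rewrite /lin_prod (perm_big _ (permEl (perm_sort _ _))) /= big_map rmorph_prod.
rewrite big_seq [RHS]big_seq; apply: eq_bigr => w ws.
by rewrite rmorphB /= map_polyX map_polyC /= s_real.
Qed.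

Lemma lin_prod_neq0 (R : nzRingType) (s : seq R) : lin_prod s != 0.
Proof. by rewrite monic_neq0 // monic_prod => // a; rewrite monicXsubC. Qed.

Lemma mup_lin_prod (R : fieldType) (a : R) (s : seq R) : mup a (lin_prod s) = count_mem a s.
Proof.
elim: s => [|b s IHs]; first by rewrite /lin_prod big_nil mupNroot // root1.
have Xb_neq0 : 'X - b%:P != 0 by rewrite polyXsubC_eq0.
rewrite /lin_prod big_cons mupM ?lin_prod_neq0 // -/(lin_prod s) IHs.
by rewrite -(expr1 ('X - b%:P)) mup_XsubCX /=; case: eqP.
Qed.

Lemma mupZ (R : fieldType) (a c : R) (p : {poly R}) : c != 0 -> mup a (c *: p) = mup a p.
Proof. by move=> c_neq0; rewrite -mul_polyC mupMr // rootC. Qed.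

Lemma zeros_with_mult_lin_prod (R : realType) (p : {poly R}) (u : seq R) :
  real_rooted p -> p != 0 -> zeros_with_mult p u -> p = lead_coef p *: lin_prod u.
Proof.
move=> rr p_neq0 [_ count_u]; have [w _ pE] := real_rooted_lin_prod rr p_neq0.
rewrite {1}pE /lin_prod; congr (_ *: _); apply: perm_big; apply/allP => b _ /=.
rewrite count_u pE mupZ ?mup_lin_prod //.
by rewrite lead_coef_eq0.
Qed.

(** * From alternating zeros to cross inequalities *)

(** Removing the largest zero [u1] from [u] makes [v] the list with the larger
head, so the induction exchanges the two lists. The second inequality has to be
carried along, for every [a] above [u]: the induction hypothesis at [a := u1]
is the first inequality, because [(z - u1) * f] is the whole product over
[u1 :: u]; and its first inequality gives the second one at [a := u1], from
which other values of [a] differ by a nonnegative multiple of the first. *)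
Lemma cross_alternate (R : realType) (z : R[i]) (v u : seq R) : 0 < complex.Im z ->
  sorted (fun x y => y <= x) v -> sorted (fun x y => y <= x) u -> alternate v u ->
  size u = size v \/ size u = (size v).+1 ->
  0 <= cross (\prod_(b <- u) (z - b%:C%C)) (\prod_(b <- v) (z - b%:C%C)) /\
  forall a, all (fun b => b <= a) u ->
    0 <= cross ((z - a%:C%C) * \prod_(b <- v) (z - b%:C%C)) (\prod_(b <- u) (z - b%:C%C)).
Proof.
move=> z_gt0; have [n] := ubnP (size u + size v).
elim: n v u => // n IHn v [|u1 u] lt_n sort_v sort_u [alt1 alt2] size_uv.
  have -> : v = [::] by case: v size_uv {lt_n sort_v alt1 alt2} => //= ? ? [].
  rewrite big_nil crossvv; split=> // a _; rewrite crossMl mulr_ge0 ?sqmod_ge0 //.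
  by case: (z) z_gt0 => x y /= y_gt0; rewrite subr0 ltW.
have [|||IH1 IH2] := IHn u v _ (path_sorted sort_u) sort_v.
- by rewrite addnC; move: lt_n; rewrite /= addSn ltnS.
- split=> i ? ?; first exact: alt2.
  exact: (alt1 i.+1).
- by move: size_uv => /= [|[]] ->; [right | left].
have v_le_u1 : all (fun b => b <= u1) v.
  apply/(all_nthP 0) => i lt_i; apply: le_trans (alt1 0%N _ _) => //; last first.
    exact: leq_ltn_trans lt_i.
  apply: (sorted_leq_nth (leT := fun x y => y <= x) _ _ 0 sort_v) => //.
  - by move=> x y w xy yw; apply: le_trans xy.
  - by rewrite inE (leq_ltn_trans _ lt_i).
rewrite big_cons; set f := \prod_(b <- u) _ in IH1 IH2 *; set g := \prod_(b <- v) _ in IH1 IH2 *.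
have fg_ge0 : 0 <= cross ((z - u1%:C%C) * f) g by exact: IH2.
split=> // a /= /andP[le_u1a _].
have -> : (z - a%:C%C) * g = (z - u1%:C%C) * g - (a - u1)%:C%C * g by rewrite rmorphB; ring.
rewrite crossDl crossM2l addr_ge0 ?mulr_ge0 ?sqmod_ge0 //.
by rewrite crossC crossNr opprK crossZr mulr_ge0 // subr_ge0.
Qed.

(** A polynomial with nonnegative coefficients is positive on the positive
half-line. *)
Lemma root_le0 (R : realDomainType) (p : {poly R}) (x : R) : (forall i, 0 <= p`_i) ->
  p != 0 -> root p x -> x <= 0.
Proof.
move=> p_ge0 p_neq0 /eqP px; rewrite leNgt; apply/negP => x_gt0.
have: 0 < p.[x]; last by rewrite px ltxx.
rewrite horner_coef -(prednK (_ : 0 < size p)%N) ?size_poly_gt0 // big_ord_recr /=.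
rewrite ltr_wpDl ?sumr_ge0 // => [i _|]; first by rewrite mulr_ge0 // exprn_ge0 ?ltW.
by rewrite mulr_gt0 ?exprn_gt0 // lt0r p_ge0 andbT -/(lead_coef p) lead_coef_eq0.
Qed.

Lemma horner_linearC (R : rcfType) (b c : R) (z : R[i]) :
  (cpoly (b *: 'X + c%:P)).[z] = Complex (b * complex.Re z + c) (b * complex.Im z).
Proof.
rewrite rmorphD /= linearZ /= map_polyX map_polyC !hornerE /=.
by case: z => x y; apply/eqP; rewrite eq_complex /=; apply/andP; split; apply/eqP; ring.
Qed.

Lemma real_rooted_linear (R : realType) (b c : R) :
  b *: 'X + c%:P = 0 \/ real_rooted (b *: 'X + c%:P).
Proof.
have [->|b_neq0] := eqVneq b 0; last first.
  right; apply/real_rooted_im_gt0 => z z_gt0.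
  by rewrite horner_linearC eq_complex negb_and /= mulf_eq0 (negPf b_neq0) (gt_eqF z_gt0) ?orbT.
have [->|c_neq0] := eqVneq c 0; first by left; rewrite scale0r addr0.
right; apply/real_rooted_im_gt0 => z _.
by rewrite horner_linearC eq_complex /= mul0r add0r (negPf c_neq0).
Qed.

Lemma interlaces_real_rooted (R : realType) (g f : {poly R}) : interlaces g f ->
  (g = 0 \/ real_rooted g) /\ (f = 0 \/ real_rooted f).
Proof.
case=> [v u rr_g rr_f _ _ _ _ _ _|a b c _ _ _ -> ->|-> ?|-> ?]; try by tauto.
split; last exact: real_rooted_linear.
by have := real_rooted_linear 0 a; rewrite scale0r add0r.
Qed.

(** As the zeros of [f] are nonpositive, [cross_alternate] applies with
[a := 0], which is where nonnegativity of the coefficients enters. *)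
Lemma cross_interlaces (R : realType) (g f : {poly R}) (z : R[i]) :
  0 < complex.Im z -> (forall i, 0 <= f`_i) -> interlaces g f ->
  0 <= cross (cpoly f).[z] (cpoly g).[z] /\ 0 <= cross (z * (cpoly g).[z]) (cpoly f).[z].
Proof.
move=> z_gt0 f_ge0.
case=> [v u rr_g rr_f g_gt0 f_gt0 size_gf zg zf alt|a b c a_ge0 b_ge0 c_ge0 -> ->|-> _|-> _].
- have g_neq0 : g != 0 by rewrite -lead_coef_eq0 gt_eqF.
  have f_neq0 : f != 0 by rewrite -lead_coef_eq0 gt_eqF.
  have gE := zeros_with_mult_lin_prod rr_g g_neq0 zg.
  have fE := zeros_with_mult_lin_prod rr_f f_neq0 zf.
  have size_uv : size u = size v \/ size u = (size v).+1.
    move: size_gf; rewrite fE gE !size_scale ?gt_eqF // !size_prod_XsubC.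
    by case=> -[->]; [left | right].
  have u_le0 : all (fun b => b <= 0) u.
    apply/allP => x xu; apply: (root_le0 f_ge0 f_neq0).
    by rewrite fE rootZ ?gt_eqF // root_prod_XsubC.
  have [fg /(_ 0 u_le0)] := cross_alternate z_gt0 zg.1 zf.1 alt size_uv.
  rewrite fE gE !linearZ /= !hornerZ !horner_lin_prodC subr0 [z * (_ * _)]mulrCA => gf.
  by rewrite !crossZl !crossZr; split; do 2![apply: mulr_ge0; first exact: ltW].
- rewrite horner_linearC map_polyC hornerC.
  case: z z_gt0 => x y /= y_gt0; rewrite /cross /=.
  have -> : b * y * a - (b * x + c) * 0 = a * b * y by ring.
  have -> : (x * 0 + y * a) * (b * x + c) - (x * a - y * 0) * (b * y) = a * c * y by ring.
  by rewrite !mulr_ge0 // ltW.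
- by rewrite rmorph0 horner0 mulr0 cross0l crossC cross0l oppr0.
- by rewrite rmorph0 horner0 cross0l crossC cross0l oppr0.
Qed.

(** * Local behaviour at a real point *)

(** Separates the real and the imaginary part of a complex polynomial along the
real line, so that a cross product of values becomes a real polynomial. *)
Lemma polyC_horner_real (R : rcfType) (p : {poly R[i]}) :
  exists A B : {poly R}, forall t : R, p.[t%:C%C] = Complex A.[t] B.[t].
Proof.
elim/poly_ind: p => [|p [x y] [A [B E]]].
  by exists 0, 0 => t; rewrite !horner0.
exists (A * 'X + x%:P), (B * 'X + y%:P) => t; rewrite !hornerE E.
by apply/eqP; rewrite eq_complex /=; apply/andP; split; apply/eqP; ring.
Qed.

Lemma horner_ge0_right (R : rcfType) (p : {poly R}) :
  (forall t, 0 < t -> 0 <= p.[t]) -> 0 <= p.[0].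
Proof.
move=> p_ge0; rewrite leNgt; apply/negP => p_lt0.
have [d d_gt0 /(_ (d / 2))] := @poly_cont R 0 p (- p.[0]) ltac:(by rewrite oppr_gt0).
have d2 : 0 < d / 2 by lra.
rewrite subr0 gtr0_norm // => /(_ ltac:(lra)).
have := p_ge0 _ d2; rewrite ltr_norml => ? /andP[_]; lra.
Qed.

Lemma cross_horner_ge0 (R : rcfType) (p q : {poly R[i]}) :
  (forall t : R, 0 < t -> 0 <= cross p.[t%:C%C] q.[t%:C%C]) ->
  0 <= cross p.[0] q.[0].
Proof.
have [A [B pE]] := polyC_horner_real p; have [C [D qE]] := polyC_horner_real q.
have crossE t : cross p.[t%:C%C] q.[t%:C%C] = (B * C - A * D).[t].
  by rewrite pE qE !hornerE.
have <- : 0%:C%C = 0 :> R[i] by [].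
move=> h; rewrite crossE; apply: horner_ge0_right => t t0.
by rewrite -crossE; apply: h.
Qed.

(** The root chosen by [k.-root] has nonnegative imaginary part as soon as
[1 < k], and a real number has no power equal to [c * 'i]. *)
Lemma root_im_gt0 (R : rcfType) (k : nat) (c : R) : (1 < k)%N -> c != 0 ->
  exists2 w : R[i], 0 < complex.Im w & w ^+ k = Complex 0 c.
Proof.
move=> k_gt1 c_neq0; pose w : R[i] := k.-root (Complex 0 c).
have wE : w ^+ k = Complex 0 c by rewrite rootCK // ltnW.
exists w => //; rewrite lt0r; apply/andP; split; last first.
  by rewrite -ler0c complexIm Im_rootC_ge0.
apply: contraNneq c_neq0 => im0.
have wr : w = (complex.Re w)%:C%C by case: (w) im0 => x y /= ->.
by move: wE; rewrite wr -rmorphXn => -[_ ->].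
Qed.

(** Dividing by a square modulus leaves [(z - a) ^+ k * P(z)] against [Q(z)]. On
the ray [z = a + w * t] with [t] tending to 0 from above, the limit is
[complex.Im (w ^+ k) * P.[a] * Q.[a] >= 0] for every [w] in the upper
half-plane. For [k = 1] take [w = 'i]; for [k >= 2] the imaginary part of
[w ^+ k] takes both signs. *)
Lemma cross_local (R : rcfType) (a : R) (k m : nat) (P Q : {poly R}) :
  P.[a] != 0 -> Q.[a] != 0 ->
  (forall z, 0 < complex.Im z ->
     0 <= cross ((z - a%:C%C) ^+ (m + k) * (cpoly P).[z]) ((z - a%:C%C) ^+ m * (cpoly Q).[z])) ->
  k = 0%N \/ k = 1%N /\ 0 < P.[a] * Q.[a].
Proof.
move=> Pa Qa PQ.
have lim (w : R[i]) : 0 < complex.Im w -> 0 <= complex.Im (w ^+ k) * (P.[a] * Q.[a]).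
  move=> w_gt0; pose l : {poly R[i]} := w *: 'X + (a%:C%C)%:P.
  have lE z : l.[z] = w * z + a%:C%C by rewrite /l !hornerE.
  have -> : complex.Im (w ^+ k) * (P.[a] * Q.[a]) =
      cross (w ^+ k *: (cpoly P \Po l)).[0] (cpoly Q \Po l).[0].
    rewrite hornerZ !horner_comp lE mulr0 add0r !horner_map.
    by case: (w ^+ k) => x y; rewrite /cross /=; ring.
  apply: cross_horner_ge0 => t t_gt0; rewrite hornerZ !horner_comp lE.
  have im_gt0 : 0 < complex.Im (w * t%:C%C + a%:C%C).
    case: (w) w_gt0 => x y /= y_gt0; rewrite mulr0 add0r addr0; exact: mulr_gt0.
  have wt_neq0 := Im_pos_neq_real a im_gt0.
  have := PQ _ im_gt0; rewrite exprD -mulrA crossM2l.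
  rewrite pmulr_rge0; last by apply/sqmod_gt0/expf_neq0.
  rewrite addrK exprMn.
  rewrite [w ^+ k * _]mulrC -rmorphXn -mulrA crossZl pmulr_rge0 //.
  exact: exprn_gt0.
case: k {PQ} lim => [|[|k]] lim; [by left | right; split=> // | ].
  (* The case [k = 1], with [w = 'i]. *)
  have := lim (Complex 0 1) ltr01; rewrite expr1 mul1r.
  by rewrite [0 < _]lt0r mulf_neq0.
(* A direction [w] with [w ^+ k] equal to ['i] times a number of the wrong sign. *)
have PQa : - (P.[a] * Q.[a]) != 0 by rewrite oppr_eq0 mulf_neq0.
have [w w_gt0 wE] := root_im_gt0 (isT : 1 < k.+2)%N PQa.
have := lim w w_gt0; rewrite wE /= mulNr oppr_ge0 -expr2.
by rewrite real_exprn_even_le0 ?num_real //= mulf_eq0 (negPf Pa) (negPf Qa).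
Qed.

(** * From cross inequalities to alternating zeros *)

Definition above (R : rcfType) (a : R) (s : seq R) : nat := count (fun b => a < b) s.

Definition cofactor_at (R : rcfType) (a : R) (s : seq R) : {poly R} :=
  lin_prod [seq b <- s | b != a].

Lemma lin_prod_cofactor_at (R : rcfType) (a : R) (s : seq R) :
  lin_prod s = ('X - a%:P) ^+ count_mem a s * cofactor_at a s.
Proof.
elim: s => [|b s]; rewrite /cofactor_at /lin_prod /= ?big_nil ?mulr1 //.
rewrite big_cons => ->; have [->|ba] /= := eqVneq b a.
  by rewrite exprS mulrA.
by rewrite big_cons mulrCA.
Qed.

(** Each zero above [a] contributes one negative factor. *)
Lemma cofactor_at_sign (R : rcfType) (a : R) (s : seq R) :
  0 < (-1) ^+ above a s * (cofactor_at a s).[a].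
Proof.
elim: s => [|b s]; rewrite /cofactor_at /lin_prod /= ?big_nil ?hornerC ?mulr1 //.
move=> IHs; have [ab|ba|<-] /= := ltrgtP a b; rewrite ?add0n //.
  rewrite big_cons hornerM hornerXsubC exprS mulrACA.
  by rewrite mulr_gt0 // mulN1r oppr_gt0 subr_lt0.
rewrite big_cons hornerM hornerXsubC mulrCA.
by rewrite mulr_gt0 // subr_gt0.
Qed.

Lemma cofactor_at_parity (R : rcfType) (a : R) (u v : seq R) :
  (cofactor_at a u).[a] != 0 /\ (cofactor_at a v).[a] != 0 /\
  ((0 < (cofactor_at a u).[a] * (cofactor_at a v).[a]) = ~~ odd (above a u + above a v)).
Proof.
have [su sv] := (cofactor_at_sign a u, cofactor_at_sign a v).
have neq0 s : 0 < (-1) ^+ above a s * (cofactor_at a s).[a] -> (cofactor_at a s).[a] != 0.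
  by move=> sgt; apply: contraTneq sgt => ->; rewrite mulr0 ltxx.
do 2![split; first exact: neq0].
have := mulr_gt0 su sv; rewrite mulrACA -exprD -signr_odd.
case: odd; rewrite /= ?expr0 ?mul1r // expr1 mulN1r oppr_gt0 => h.
by apply/negbTE; rewrite -leNgt ltW.
Qed.

Lemma exists_min_mem (R : realDomainType) (s : seq R) : s != [::] ->
  exists2 b, b \in s & forall x, x \in s -> b <= x.
Proof.
move=> s_neq0; have: sorted <=%R (sort <=%R s) by apply: sort_sorted; apply: le_total.
case sE: (sort <=%R s) => [|b t] /=.
  by move: s_neq0; rewrite -size_eq0 -(size_sort <=%R) sE.
move=> /(order_path_min le_trans)/allP bt; exists b.
  by rewrite -(mem_sort <=%R) sE mem_head.
by move=> x; rewrite -(mem_sort <=%R) sE inE => /predU1P[->|/bt].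
Qed.

Lemma above_next (R : rcfType) (a b : R) (s : seq R) : a < b ->
  (forall x, x \in s -> a < x -> b <= x) -> above a s = (above b s + count_mem b s)%N.
Proof.
move=> ab bP; rewrite -count_predUI.
rewrite [count (predI _ _) _](_ : _ = 0)%N ?addn0; last first.
  by apply/eqP; rewrite -leqn0 leqNgt -has_count; apply/hasPn => x _ /=;
     apply/negP => /andP[/= bx /eqP xb]; rewrite xb ltxx in bx.
apply: eq_in_count => x xs /=; have [bx|xb|bx] := ltgtP b x; rewrite ?orbT /=.
- by rewrite (lt_trans ab bx).
- by apply/negbTE/negP => /(bP _ xs); rewrite leNgt xb.
- by rewrite -bx ab.
Qed.

(** Induction on the number of zeros above [a], through the least zero [b] of
either polynomial above [a]. By [cross_local] the multiplicities at [b] differ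
by at most one, and the sign condition, read as a parity by
[cofactor_at_parity], lets the difference of the counts grow from 0 only and
drop from 1 only. *)
Lemma above_cross (R : rcfType) (u v : seq R) (a : R) :
  (forall z, 0 < complex.Im z -> 0 <= cross (cpoly (lin_prod u)).[z] (cpoly (lin_prod v)).[z]) ->
  above a u = above a v \/ above a u = (above a v).+1.
Proof.
move=> uv; have [n] := ubnP (above a u + above a v).
elim: n a => // n IHn a; rewrite ltnS => le_n.
pose s := [seq x <- u ++ v | a < x].
have [s0|/exists_min_mem[b bs b_min]] := eqVneq s [::].
  left; have: count (fun b => a < b) (u ++ v) = 0%N by rewrite -size_filter -/s s0.
  by rewrite count_cat => /eqP; rewrite addn_eq0 => /andP[/eqP au /eqP av]; rewrite /above au av.
move: bs; rewrite mem_filter => /andP[ab b_uv].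
have auE : above a u = (above b u + count_mem b u)%N.
  by apply: above_next => // x xu ax; apply: b_min; rewrite mem_filter ax mem_cat xu.
have avE : above a v = (above b v + count_mem b v)%N.
  by apply: above_next => // x xu ax; apply: b_min; rewrite mem_filter ax mem_cat xu orbT.
have : (0 < count_mem b u + count_mem b v)%N by rewrite -count_cat -has_count has_pred1.
have factor (t : seq R) z : (cpoly (lin_prod t)).[z] =
    (z - b%:C%C) ^+ count_mem b t * (cpoly (cofactor_at b t)).[z].
  rewrite (lin_prod_cofactor_at b t) rmorphM rmorphXn rmorphB /= map_polyX map_polyC.
  by rewrite hornerM horner_exp hornerXsubC.
have [Fu [Fv parity]] := cofactor_at_parity b u v.
move: (IHn b); rewrite auE avE in le_n *.
have [le_vu|lt_uv] := leqP (count_mem b v) (count_mem b u) => IHb mult_gt0.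
  have := @cross_local R b (count_mem b u - count_mem b v) (count_mem b v) _ _ Fu Fv.
  case=> [z z_gt0|h|[h]].
  - by rewrite subnKC // -!factor; apply: uv.
  - by have := IHb ltac:(lia); lia.
  - by rewrite parity; have := IHb ltac:(lia); lia.
(* Exchanging the roles of the polynomials and changing one sign preserves the
   cross product. *)
have := @cross_local R b (count_mem b v - count_mem b u) (count_mem b u)
  (cofactor_at b v) (- cofactor_at b u) Fv.
rewrite hornerN oppr_eq0 => /(_ Fu).
case=> [z z_gt0|h|[h]].
- by rewrite subnKC 1?ltnW // rmorphN hornerN mulrN crossNr -crossC -!factor; apply: uv.
- lia.
- rewrite mulrN oppr_gt0 mulrC => FF.
  have : odd (above b u + above b v) by rewrite -[odd _]negbK -parity -leNgt ltW.
  by have := IHb ltac:(lia); lia.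
Qed.

Lemma above_nth (R : rcfType) (s : seq R) (i : nat) :
  sorted (fun x y => y <= x) s -> (i < size s)%N -> (above s`_i s <= i)%N.
Proof.
move=> sort_s lt_is; rewrite /above -{2}(cat_take_drop i s) count_cat.
rewrite [count _ (drop i s)](_ : _ = 0)%N ?addn0.
  by rewrite (leq_trans (count_size _ _)) // size_take lt_is.
apply/eqP; rewrite -leqn0 leqNgt -has_count; apply/hasPn => x /(nthP 0)[j].
rewrite size_drop nth_drop => lt_j <-; rewrite -leNgt.
apply: (sorted_leq_nth (leT := fun x y => y <= x) _ _ 0 sort_s) => //.
- by move=> p q w pq qw; apply: le_trans pq.
- by rewrite inE -ltn_subRL.
- exact: leq_addr.
Qed.

Lemma above_lt_nth (R : rcfType) (a : R) (s : seq R) (i : nat) :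
  sorted (fun x y => y <= x) s -> (i < size s)%N -> a < s`_i -> (i < above a s)%N.
Proof.
move=> sort_s lt_is lt_a; rewrite /above -(cat_take_drop i.+1 s) count_cat.
have /eqP-> : count (fun b => a < b) (take i.+1 s) == i.+1.
  rewrite -{2}(size_takel lt_is) -all_count; apply/(all_nthP 0) => j.
  rewrite size_takel // => lt_j; rewrite nth_take //; apply: lt_le_trans lt_a _.
  apply: (sorted_leq_nth (leT := fun x y => y <= x) _ _ 0 sort_s) => //.
  - by move=> p q w pq qw; apply: le_trans pq.
  - by rewrite inE; apply: leq_ltn_trans lt_is; rewrite -ltnS.
by rewrite leq_addr.
Qed.

Lemma alternate_above (R : realType) (u v : seq R) :
  sorted (fun x y => y <= x) u -> sorted (fun x y => y <= x) v ->
  (forall a, above a u = above a v \/ above a u = (above a v).+1) ->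
  alternate v u /\ (size u = size v \/ size u = (size v).+1).
Proof.
move=> sort_u sort_v uv; split; last first.
  (* Below all the zeros, the counts are the lengths of the lists. *)
  have [b b_lt] : exists b, forall x, x \in u ++ v -> b < x.
    have [->|/exists_min_mem[b _ b_min]] := eqVneq (u ++ v) [::]; first by exists 0.
    by exists (b - 1) => x /b_min; apply: lt_le_trans; rewrite gtrBl.
  have aboveE s : {subset s <= u ++ v} -> above b s = size s.
    by move=> s_uv; apply/eqP; rewrite -all_count; apply/allP => x /s_uv/b_lt.
  have := uv b; rewrite !aboveE // => x xs; by rewrite mem_cat xs ?orbT.
split=> i lt_iv lt_iu; rewrite leNgt; apply/negP => lt.
  have := above_lt_nth sort_v lt_iv lt; rewrite ltnNge => /negP[].
  by apply: leq_trans (above_nth sort_u lt_iu); case: (uv u`_i) => ->.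
have := above_lt_nth sort_u lt_iu lt; rewrite ltnNge => /negP[].
by apply: leq_trans (above_nth sort_v lt_iv : _ < i.+1)%N; case: (uv v`_i) => ->.
Qed.

(** Converse of [cross_interlaces]: the counts of zeros above every real point,
which [above_cross] compares, determine the order of the zeros. *)
Lemma interlaces_cross (R : realType) (f g : {poly R}) :
  0 < lead_coef f -> 0 < lead_coef g -> real_rooted f -> real_rooted g ->
  (forall z, 0 < complex.Im z -> 0 <= cross (cpoly f).[z] (cpoly g).[z]) ->
  interlaces g f.
Proof.
move=> f_gt0 g_gt0 rr_f rr_g fg.
have [f_neq0 g_neq0] : f != 0 /\ g != 0.
  by rewrite -!lead_coef_eq0 !gt_eqF.
have [u sort_u fE] := real_rooted_lin_prod rr_f f_neq0.
have [v sort_v gE] := real_rooted_lin_prod rr_g g_neq0.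
have uv a : above a u = above a v \/ above a u = (above a v).+1.
  apply: above_cross => z /fg.
  rewrite fE gE !linearZ /= !hornerZ crossZl crossZr.
  by rewrite !pmulr_rge0.
have [alt size_uv] := alternate_above sort_u sort_v uv.
apply: (@InterlacesZeros _ _ _ v u) => //.
- rewrite fE gE !size_scale ?gt_eqF // !size_prod_XsubC.
  by case: size_uv => ->; [left | right].
- by split=> // a; rewrite gE mupZ ?mup_lin_prod ?gt_eqF.
- by split=> // a; rewrite fE mupZ ?mup_lin_prod ?gt_eqF.
Qed.

(** * Sections of a product with a geometric sum *)

(** The [k]-th section of ['X^j * h] is the section [k - j] of [h] if [j <= k],
and ['X] times the section [k + r - j] of [h] otherwise. *)
Lemma poly_section_geomM (R : comNzRingType) (r k : nat) (h : {poly R}) : (k < r)%N ->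
  poly_section r k ((\sum_(i < r) 'X^i) * h) =
  wrapped_sum 'X r (fun i => poly_section r i h) k.
Proof.
move=> lt_kr; have r_gt0 : (0 < r)%N by apply: leq_ltn_trans lt_kr.
apply/polyP => m; rewrite coef_poly_section // mulr_suml coef_sum.
rewrite -(big_mkord xpredT (fun j => ('X^j * h)`_(r * m + k))).
rewrite (@big_cat_nat _ _ _ k.+1) //= /wrapped_sum coefD coefXM !coef_sum; congr (_ + _).
  rewrite big_nat_rev /= !big_nat; apply: eq_bigr => j /= lt_jk.
  rewrite coef_poly_section // coefXnM ltnNge (_ : (_ <= _)%N) ?add0n /=; last lia.
  by congr h`_ _; lia.
rewrite big_nat_rev /=; case: m => [|m] /=.
  rewrite big_nat big1 // => j /andP[? ?]; rewrite coefXnM (_ : (_ < _)%N) //; lia.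
rewrite !big_nat; apply: eq_bigr => j /andP[lt_kj lt_jr].
rewrite coef_poly_section // coefXnM ltnNge (_ : (_ <= _)%N) /=; last lia.
by congr h`_ _; rewrite mulnS; lia.
Qed.

Lemma horner_wrapped_sum (R : rcfType) (r k : nat) (f : nat -> {poly R}) (z : R[i]) :
  (cpoly (wrapped_sum 'X r f k)).[z] = wrapped_sum z r (fun i => (cpoly (f i)).[z]) k.
Proof.
by rewrite /wrapped_sum rmorphD rmorphM /= map_polyX !rmorph_sum !hornerE !horner_sum.
Qed.

Lemma lead_coef_gt0_of_coef (R : realDomainType) (p : {poly R}) : (forall i, 0 <= p`_i) ->
  p = 0 \/ 0 < lead_coef p.
Proof.
move=> p_ge0; have [->|p_neq0] := eqVneq p 0; [by left | right].
by rewrite lt0r lead_coef_eq0 p_neq0 p_ge0.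
Qed.

(** The property of [h] that is preserved by multiplication with the geometric
sum. For nonnegative coefficients and [1 < r] it is equivalent to interlacing of
the sections; for [r = 1] interlacing does not force the only section to be
real-rooted. *)
Definition fan_sections (R : realType) (r : nat) (h : {poly R}) : Prop :=
  [/\ forall i, 0 <= h`_i,
      forall z, 0 < complex.Im z -> in_fan z r (fun k => (cpoly (poly_section r k h)).[z])
    & forall k, (k < r)%N -> poly_section r k h = 0 \/ real_rooted (poly_section r k h)].

(** At a point of the upper half-plane where a new section vanishes,
[wrapped_sum_eq0] makes all the old sections vanish. This is impossible for one
that is nonzero and real-rooted; and if they are all zero, so are the new
ones. *)
Lemma fan_sections_geomM (R : realType) (r : nat) (h : {poly R}) :
  fan_sections r h -> fan_sections r ((\sum_(i < r) 'X^i) * h).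
Proof.
case=> h_ge0 h_fan h_rr; split=> [i|z z_gt0|k lt_kr].
- rewrite mulr_suml coef_sum sumr_ge0 // => j _; rewrite coefXnM.
  by case: ifP.
- move=> k l lt_kl lt_lr; rewrite !poly_section_geomM ?(ltn_trans lt_kl) //.
  by rewrite !horner_wrapped_sum; apply: in_fan_wrapped_sum (h_fan z z_gt0) _ _ _ _.
rewrite poly_section_geomM //.
have [all0|/forallPn[i f_neq0]] := boolP [forall i : 'I_r, poly_section r i h == 0].
  have f0 i : (i < r)%N -> poly_section r i h = 0.
    by move=> lt_ir; apply/eqP/(forallP all0 (Ordinal lt_ir)).
  left; rewrite /wrapped_sum !big_nat !big1 ?mulr0 ?addr0 // => i.
    by case/andP=> _ /f0.
  by rewrite ltnS => le_ik; apply: f0; apply: leq_ltn_trans lt_kr.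
right; apply/real_rooted_im_gt0 => z z_gt0; rewrite horner_wrapped_sum; apply/eqP => t0.
have := wrapped_sum_eq0 z_gt0 (h_fan z z_gt0) lt_kr t0 (ltn_ord i); apply/eqP.
have [f0|rr] := h_rr i (ltn_ord i); first by rewrite f0 eqxx in f_neq0.
by move: z z_gt0 {t0}; apply/real_rooted_im_gt0.
Qed.

Lemma nth_rev_map_iota (V : nmodType) (r k : nat) (F : nat -> V) : (k < r)%N ->
  (rev [seq F k | k <- iota 0 r])`_(r - k.+1) = F k.
Proof.
move=> lt_kr; rewrite nth_rev size_map size_iota; last lia.
rewrite (_ : r - (r - k.+1).+1 = k)%N; last lia.
by rewrite (nth_map 0%N) ?size_iota // nth_iota.
Qed.

Lemma interlacing_fan_sections (R : realType) (r : nat) (h : {poly R}) : (1 < r)%N ->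
  (forall i, 0 <= h`_i) -> interlacing (rev [seq poly_section r k h | k <- iota 0 r]) ->
  fan_sections r h.
Proof.
move=> r_gt1 h_ge0 [_ inter].
have f_inter k l : (k < l)%N -> (l < r)%N ->
    interlaces (poly_section r l h) (poly_section r k h).
  move=> lt_kl lt_lr; have lt_kr := ltn_trans lt_kl lt_lr.
  rewrite -(nth_rev_map_iota (fun k => poly_section r k h) lt_lr).
  rewrite -(nth_rev_map_iota (fun k => poly_section r k h) lt_kr).
  by apply: inter; rewrite ?size_rev ?size_map ?size_iota; lia.
split=> // [z z_gt0 k l lt_kl lt_lr|k lt_kr].
  apply: cross_interlaces => // [i|]; last exact: f_inter.
  by rewrite coef_poly_section // ltnW.
case: k lt_kr => [|k] lt_kr.
  by have [] := interlaces_real_rooted (f_inter 0%N 1%N isT r_gt1).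
by have [] := interlaces_real_rooted (f_inter 0%N k.+1 isT lt_kr).
Qed.

Lemma fan_sections_interlacing (R : realType) (r : nat) (h : {poly R}) :
  (0 < r)%N -> (forall i, 0 <= h`_i) -> ((1 < r)%N -> fan_sections r h) ->
  interlacing (rev [seq poly_section r k h | k <- iota 0 r]).
Proof.
move=> r_gt0 h_ge0 h_fan.
have f_gt0 k : poly_section r k h = 0 \/ 0 < lead_coef (poly_section r k h).
  by apply: lead_coef_gt0_of_coef => i; rewrite coef_poly_section.
split=> [f|i j lt_ij]; first by rewrite mem_rev => /mapP[k _ ->].
rewrite size_rev size_map size_iota => lt_jr.
have [_ h_cross h_rr] := h_fan (leq_ltn_trans (leq_ltn_trans (leq0n i) lt_ij) lt_jr).
(* In the reversed list, larger positions carry smaller section indices. *)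
pose k := (r - j.+1)%N; pose l := (r - i.+1)%N.
have lt_kl : (k < l)%N by rewrite /k /l; lia.
have lt_lr : (l < r)%N by rewrite /l; lia.
have lt_kr := ltn_trans lt_kl lt_lr.
have -> : i = (r - l.+1)%N by rewrite /l; lia.
have -> : j = (r - k.+1)%N by rewrite /k; lia.
rewrite !nth_rev_map_iota //.
have [l0|l_gt0] := f_gt0 l; first by apply: InterlacesZeroLeft => //; apply: h_rr.
have [k0|k_gt0] := f_gt0 k; first by apply: InterlacesZeroRight => //; apply: h_rr.
have rr m : (m < r)%N -> 0 < lead_coef (poly_section r m h) -> real_rooted (poly_section r m h).
  by move=> /h_rr[->|//]; rewrite lead_coef0 ltxx.
apply: interlaces_cross => //; [exact: rr | exact: rr |].
by move=> z z_gt0; have [] := h_cross z z_gt0 k l lt_kl lt_lr.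
Qed.

Theorem theorem1p4 (R : realType) (n r : nat) (h : {poly R})
    (n_gt0 : (0 < n)%N) (r_gt0 : (0 < r)%N) (h_ge0 : forall i : nat, 0 <= h`_i)
    (h_interl : interlacing (rev [seq poly_section r k h | k <- iota 0 r])) :
  interlacing (rev [seq U r k n h | k <- iota 0 r]).
Proof.
rewrite /U; set g := \sum_(i < r) 'X^i.
apply: fan_sections_interlacing => // [|r_gt1].
  elim: (n) => [|m IHm] i; first by rewrite expr0 mul1r.
  rewrite exprS -mulrA mulr_suml coef_sum sumr_ge0 // => j _; rewrite coefXnM.
  by case: ifP.
elim: (n) => [|m IHm]; first by rewrite expr0 mul1r; apply: interlacing_fan_sections.
by rewrite exprS -mulrA; apply: fan_sections_geomM.
Qed.
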